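(* Let $q=p^l$, where $p$ is an odd prime and $l\ge 2$ is an integer, and put $n=q+1$ and $a=\frac n2$. Then there exist asymmetric quantum convolutional codes with the following parameters, each for some memory $\mu^*$: (a) $[(n,\ 2i-2t-2,\ \mu^*;\ 6,\ (d_z)_f/(d_x)_f)]_q$, where $(d_z)_f\ge n-2i$ and $(d_x)_f\ge 2t+2$, for all integers $i,t$ with $1\le t\le i-2$ and $3\le i\le a-1$; (b) $[(n,\ 2i-2t,\ \mu^*;\ 4,\ (d_z)_f/(d_x)_f)]_q$, where $(d_z)_f\ge n-2i$ and $(d_x)_f\ge 2t+2$, for all integers $i,t$ with $1\le t\le i-1$ and $2\le i\le a-1$. (In both items the two lower bounds are interchanged if $2t+2>n-2i$.)
   Context: Convolutional notions. A matrix over $\mathbb F_q[D]$ is basic if it has a polynomial right inverse. The weight of $\mathbf v(D)\in\mathbb F_q[D]^n$ is the total number of nonzero coefficients of its $n$ components. The Euclidean dual of a submodule $V\subseteq\mathbb F_q[D]^n$ is $V^\perp=\{\mathbf u(D)\in\mathbb F_q[D]^n:\ \mathbf u(D)\mathbf v(1/D)^t=0\ \text{for all }\mathbf v(D)\in V\}$ (the superscript $t$ on vectors and matrices denotes transpose). Asymmetric quantum convolutional code (AQCC), CSS type. It is specified by a basic (hence full-rank) stabilizer matrix $$S(D)=\begin{pmatrix}A(D)&|&0\\0&|&B(D)\end{pmatrix},\quad A\in\mathbb F_q[D]^{r\times n},\ B\in\mathbb F_q[D]^{s\times n},\quad A(D)B(1/D)^t=0$$ (symplectic orthogonality). Let $\mathcal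 A,\mathcal B\subseteq\mathbb F_q[D]^n$ be the row modules of $A$ and $B$; then $\mathcal A\subseteq\mathcal B^\perp$ and $\mathcal B\subseteq\mathcal A^\perp$. The code has parameters $[(n,K,\mu^*;\gamma,(d_z)_f/(d_x)_f)]_q$, where: $n$ is the frame size; $K=n-r-s$ is the number of logical qudits per frame; $\mu^*$ is the memory, i.e. the maximal degree of an entry of $S(D)$; $\gamma$ is the degree, i.e. the overall constraint length (sum over the rows of $S(D)$ of the maximal degree in the row), required to be minimal among all basic matrices with the same row module; and, with $\operatorname{wt}(T)$ denoting the minimum weight of an element of $T$, $(d_z)_f$ and $(d_x)_f$ are respectively the maximum and the minimum of the two numbers $\operatorname{wt}(\mathcal B^\perp\setminus\mathcal A)$ and $\operatorname{wt}(\mathcal A^\perp\setminus\mathcal B)$. Convention: whenever the value (bound) given for $(d_x)_f$ is larger than the one given for $(d_z)_f$, the two are interchanged. Writing $\mu^*$ means that no claim is made about the value of the memory. *)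

(* Defs.v *)
From HB Require Import structures.
From mathcomp Require Import all_boot all_order all_algebra.

Set Implicit Arguments.
Unset Strict Implicit.
Unset Printing Implicit Defensive.

Import GRing.Theory.
Local Open Scope ring_scope.

Section Convolutional.

Variable F : finFieldType.

Definition is_basic (k m : nat) (S : 'M[{poly F}]_(k, m)) : Prop :=
  exists T : 'M[{poly F}]_(m, k), S *m T = 1%:M.

Definition row_module (k m : nat) (S : 'M[{poly F}]_(k, m))
    (v : 'rV[{poly F}]_m) : Prop :=
  exists u : 'rV[{poly F}]_k, v = u *m S.

Definition wt (m : nat) (v : 'rV[{poly F}]_m) : nat :=
  (\sum_(j < m) count (fun c : F => c != 0%R) (v 0%R j))%N.

(* p(D) |-> p(1/D); the result is a Laurent polynomial in D = 'X, which we
   place in the fraction field F(D). *)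
Definition at_invD (p : {poly F}) : {fraction {poly F}} :=
  (map_poly (fun c : F => tofrac c%:P) p).[(tofrac 'X)^-1].

Definition frac_mx (k m : nat) (M : 'M[{poly F}]_(k, m)) :
  'M[{fraction {poly F}}]_(k, m) := map_mx (@tofrac _) M.

Definition invD_mx (k m : nat) (M : 'M[{poly F}]_(k, m)) :
  'M[{fraction {poly F}}]_(k, m) := map_mx at_invD M.

Definition euclid_dual (m : nat) (V : 'rV[{poly F}]_m -> Prop)
    (u : 'rV[{poly F}]_m) : Prop :=
  forall v, V v -> frac_mx u *m (invD_mx v)^T = 0.

(* Degree of a polynomial entry; the zero entry counts as degree 0. *)
Definition entry_deg (p : {poly F}) : nat := (size p).-1.

Definition memory (k m : nat) (S : 'M[{poly F}]_(k, m)) : nat :=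
  (\max_(i < k) \max_(j < m) entry_deg (S i j))%N.

Definition constraint_length (k m : nat) (S : 'M[{poly F}]_(k, m)) : nat :=
  (\sum_(i < k) \max_(j < m) entry_deg (S i j))%N.

(* The minimum is attained, so in particular V \ W is nonempty. *)
Definition is_min_wt_diff (m : nat) (V W : 'rV[{poly F}]_m -> Prop)
    (d : nat) : Prop :=
  (exists v, [/\ V v, ~ W v & wt v = d]) /\
  (forall v, V v -> ~ W v -> (d <= wt v)%N).

Definition stabilizer_mx (r s n : nat) (A : 'M[{poly F}]_(r, n))
    (B : 'M[{poly F}]_(s, n)) : 'M[{poly F}]_(r + s, n + n) :=
  block_mx A 0 0 B.

Record CSS_AQCC (r s n : nat) (A : 'M[{poly F}]_(r, n))
    (B : 'M[{poly F}]_(s, n)) (K mu gamma dz dx : nat) : Prop := {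
  aqcc_basic : is_basic (stabilizer_mx A B);
  aqcc_orthogonal : frac_mx A *m (invD_mx B)^T = 0;
  (* K = n - r - s, without truncated subtraction. *)
  aqcc_dim : (K + r + s = n)%N;
  aqcc_memory : memory (stabilizer_mx A B) = mu;
  aqcc_degree : constraint_length (stabilizer_mx A B) = gamma;
  aqcc_degree_min :
    forall (k : nat) (S : 'M[{poly F}]_(k, n + n)),
      is_basic S ->
      (forall v, row_module S v <-> row_module (stabilizer_mx A B) v) ->
      (gamma <= constraint_length S)%N;
  aqcc_dist :
    exists d1 d2 : nat,
      [/\ is_min_wt_diff (euclid_dual (row_module B)) (row_module A) d1,
          is_min_wt_diff (euclid_dual (row_module A)) (row_module B) d2,
          dz = maxn d1 d2 & dx = minn d1 d2]
}.

Definition has_AQCC (n K mu gamma : nat) (dist : nat -> nat -> Prop) : Prop :=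
  exists (r s : nat) (A : 'M[{poly F}]_(r, n)) (B : 'M[{poly F}]_(s, n))
         (dz dx : nat),
    CSS_AQCC A B K mu gamma dz dx /\ dist dz dx.

End Convolutional.

(* Lower bounds bz for dz and bx for dx, interchanged when bx > bz. *)
Definition dist_bounds (bz bx dz dx : nat) : Prop :=
  if (bz < bx)%N then (bx <= dz)%N /\ (bz <= dx)%N
  else (bz <= dz)%N /\ (bx <= dx)%N.

(* Main.v *)
Require Import Defs.
From HB Require Import structures.
From mathcomp Require Import all_boot all_order all_algebra all_field.
From mathcomp Require Import zify.
From Stdlib Require Import Classical.

Set Implicit Arguments.
Unset Strict Implicit.
Unset Printing Implicit Defensive.

Import GRing.Theory.

(** Index the [n = q + 1] coordinates by the points of [F] and a point at
    infinity.  Let [B] be the constant matrix of the evaluations of the monomials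
    [x^0, ..., x^(q-1-2i)], where only the last one has entry 1 at infinity; by the
    power sum identities over [F], the evaluations of the monomials of degree at
    most [2i], with entry 1 at infinity only for [x^(2i)], are orthogonal to it.
    Let [A] consist of the constant rows [x^0, ..., x^(2t-2)] and [x^(2i)], and of
    the single nonconstant row [x^(2t-1) + D^g x^(2t)].  A word of the dual of [A]
    with one nonzero coefficient in [D] is orthogonal to all [2t + 2] monomials, and
    has weight at least [2t + 2] by a Vandermonde argument; with two nonzero
    coefficients, each of them has weight at least [2t], and [4t >= 2t + 2].  The
    degree [g] is arbitrary: item (b) is [g = 4], and item (a) is the case [g = 6]
    of the same construction with [t + 1] in place of [t]. *)

Section ConvolutionalCodes.

Local Open Scope ring_scope.

Variable F : finFieldType.

Local Notation cst := (map_mx (@polyC F)).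

(** * Constant matrices and invariance of the degree *)

Lemma cstM (k m n : nat) (A : 'M[F]_(k, m)) (B : 'M[F]_(m, n)) :
  cst A *m cst B = cst (A *m B).
Proof. by rewrite map_mxM. Qed.

(** Each term of the Leibniz expansion takes one entry from every row, so the row bounds add up. *)
Lemma size_det_leq (m : nat) (M : 'M[{poly F}]_m) (d : 'I_m -> nat) :
  (forall i j, size (M i j) <= (d i).+1)%N ->
  (size (\det M) <= (\sum_i d i).+1)%N.
Proof.
move=> sizeM; apply: leq_trans (size_sum _ _ _) _; apply/bigmax_leqP => s _.
rewrite -signr_odd; set R := (\prod_i _)%R.
have -> : size ((-1) ^+ odd (perm.odd_perm s) * R) = size R.
  by case: odd; rewrite ?expr0 ?mul1r // expr1 mulN1r size_polyN.
apply: leq_trans (size_poly_prod_leq _ _) _.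
rewrite leq_subLR addnS ltnS -sum1_card -big_split /=.
by apply: leq_sum => i _; rewrite add1n.
Qed.

(* Row modules determine [S] up to a unimodular factor, so the degree of
   [\det (S *m P)] is an invariant; it is at most the constraint length. *)
Lemma constraint_length_min (m N gamma : nat) (S0 : 'M[{poly F}]_(m, N))
    (P : 'M[F]_(N, m)) :
  is_basic S0 -> \det (S0 *m cst P) = 'X^gamma ->
  forall (k : nat) (S : 'M[{poly F}]_(k, N)), is_basic S ->
    (forall v, row_module S v <-> row_module S0 v) ->
    (gamma <= constraint_length S)%N.
Proof.
move=> [T0 S0T0] detS0 k S [T ST] eqS.
have sub l1 l2 (S1 : 'M[{poly F}]_(l1, N)) (S2 : 'M[{poly F}]_(l2, N)) :
    (forall v, row_module S1 v -> row_module S2 v) -> exists U, S1 = U *m S2.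
  move=> sub12; have /fin_all_exists[u Eu] i : exists u, row i S1 = u *m S2.
    by apply: sub12; exists (delta_mx 0 i); rewrite -rowE.
  by exists (\matrix_i u i); apply/row_matrixP => i; rewrite row_mul rowK.
have [U SU] := sub _ _ _ _ (fun v => proj1 (eqS v)).
have [V S0V] := sub _ _ _ _ (fun v => proj2 (eqS v)).
(* Cancelling [S] and [S0] by their right inverses makes [U] and [V] mutually inverse, which also
   forces [k = m]. *)
have UV : U *m V = 1%:M 
  by rewrite -[U *m V]mulmx1 -ST mulmxA -(mulmxA U) -S0V -SU.
have VU : V *m U = 1%:M 
  by rewrite -[V *m U]mulmx1 -S0T0 mulmxA -(mulmxA V) -SU -S0V.
have ek : k = m.
  by apply/eqP; rewrite eqn_leq (mulmx1_min UV) (mulmx1_min VU).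
subst k.
have dU : \det U != 0.
  apply/eqP => U0; have := congr1 determinant UV.
  by rewrite det_mulmx U0 mul0r det1 => /esym/eqP; rewrite oner_eq0.
have sizeS i j : (size ((S *m cst P) i j) <= (\max_j entry_deg (S i j)).+1)%N.
  rewrite mxE; apply: leq_trans (size_sum _ _ _) _.
  apply/bigmax_leqP => h _; rewrite mxE mulrC mul_polyC.
  apply: leq_trans (size_scale_leq _ _) _.
  apply: leq_trans (leqSpred _) _; rewrite ltnS.
  exact: (leq_bigmax (F := fun j => entry_deg (S i j))).
have := size_det_leq sizeS.
rewrite {1}SU -mulmxA det_mulmx detS0 size_mulXn // => le_size; rewrite -ltnS.
by apply: leq_trans le_size; rewrite -addn1 leq_add2l size_poly_gt0.
Qed.

(** * Weights of coefficient vectors *)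

Definition hamming_wt (m : nat) (c : 'rV[F]_m) : nat :=
  (\sum_j (c ord0 j != 0%R))%N.

Definition coef_mx (k m : nat) (i : nat) (M : 'M[{poly F}]_(k, m)) : 'M[F]_(k, m) :=
  map_mx (coefp i) M.

Lemma coef_mx_eq0 (k m : nat) (M : 'M[{poly F}]_(k, m)) :
  (forall i, coef_mx i M = 0) -> M = 0.
Proof.
move=> M0; apply/matrixP => a b; rewrite mxE; apply/polyP => i.
by have /matrixP/(_ a b) := M0 i; rewrite !mxE coef0.
Qed.

Lemma coef_mx_cstr (k m n : nat) (i : nat) (M : 'M[{poly F}]_(k, m))
    (A : 'M[F]_(m, n)) : coef_mx i (M *m cst A) = coef_mx i M *m A.
Proof.
apply/matrixP => a b; rewrite !mxE /= coef_sum; apply: eq_bigr => j _.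
by rewrite !mxE coefMC.
Qed.

Lemma count_neq0_leq (s : seq F) (k l : nat) :
  k != l ->
  ((s`_k != 0)%R + (s`_l != 0)%R <= count (fun c : F => c != 0%R) s)%N.
Proof.
have one (r : seq F) j : ((r`_j != 0)%R <= count (fun c : F => c != 0%R) r)%N.
  elim: r j => [|c r IH] [|j] /=; rewrite ?eqxx ?leq_addr //.
  exact: leq_trans (IH j) (leq_addl _ _).
elim: s k l => [|c s IH] [|k] [|l] //= kl; rewrite ?eqxx //.
- by rewrite leq_add2l.
- by rewrite addnC leq_add2l.
- exact: leq_trans (IH k l kl) (leq_addl _ _).
Qed.

Lemma hamming_wt_coef2 (m : nat) (v : 'rV[{poly F}]_m) (k l : nat) :
  k != l ->
  (hamming_wt (coef_mx k v) + hamming_wt (coef_mx l v) <= wt v)%N.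
Proof.
move=> kl; rewrite /hamming_wt /wt -big_split /=; apply: leq_sum => j _.
by rewrite !mxE /=; apply: count_neq0_leq.
Qed.

Lemma hamming_wt_coef (m : nat) (v : 'rV[{poly F}]_m) (k : nat) :
  (hamming_wt (coef_mx k v) <= wt v)%N.
Proof.
apply: leq_trans (@hamming_wt_coef2 _ v k k.+1 _); first exact: leq_addr.
by rewrite neq_ltn ltnSn.
Qed.

(** * The substitution of 1/D and Euclidean duals *)

Definition invD : {poly F} -> {fraction {poly F}} :=
  horner_eval (tofrac 'X)^-1 \o map_poly (@tofrac {poly F} \o polyC).

HB.instance Definition _ := GRing.RMorphism.on invD.

(** By conversion: [invD] is [at_invD] written as a composite of ring morphisms, from which its
    morphism structure is inferred. *)
Lemma invD_mxE (k m : nat) (M : 'M[{poly F}]_(k, m)) :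
  invD_mx M = map_mx invD M.
Proof. by []. Qed.

Lemma invD_cst (k m : nat) (M : 'M[F]_(k, m)) :
  invD_mx (cst M) = frac_mx (cst M).
Proof.
apply/matrixP => i j; rewrite invD_mxE !mxE /invD /= map_polyC /=.
by rewrite /horner_eval hornerC.
Qed.

Lemma invD_Xn (g : nat) : invD 'X^g = (tofrac 'X)^-1 ^+ g.
Proof. by rewrite rmorphXn /= /invD /= map_polyX /horner_eval hornerX. Qed.

Lemma frac_mx_inj (k m : nat) : injective (@frac_mx F k m).
Proof.
move=> M N /matrixP eqMN; apply/matrixP => i j; apply/eqP.
by rewrite -tofrac_eq; have := eqMN i j; rewrite !mxE => ->.
Qed.

Lemma euclid_dualE (k m : nat) (S : 'M[{poly F}]_(k, m)) u :
  euclid_dual (row_module S) u <-> frac_mx u *m (invD_mx S)^T = 0.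
Proof.
split=> [dual_u | uS _ [w ->]]; last first.
  by rewrite invD_mxE map_mxM trmx_mul mulmxA uS mul0mx.
apply/matrixP => a i; rewrite ord1 mxE.
have /dual_u : row_module S (row i S) by exists (delta_mx 0 i); rewrite -rowE.
rewrite !invD_mxE => /matrixP/(_ 0 0); rewrite !mxE => {2}<-.
by apply: eq_bigr => j _; rewrite !mxE.
Qed.

Lemma euclid_dual_cst (k m : nat) (B : 'M[F]_(k, m)) u :
  euclid_dual (row_module (cst B)) u <-> u *m cst B^T = 0.
Proof.
rewrite euclid_dualE invD_cst /frac_mx map_trmx -map_mxM.
rewrite -(map_mx0 (@tofrac {poly F})) map_trmx; split=> [|->//].
exact: frac_mx_inj.
Qed.

Definition spread_mx (k m g : nat) (A0 : 'M[F]_(k, m)) (w1 w2 : 'rV[F]_m) :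
    'M[{poly F}]_(k + 1, m) :=
  col_mx (cst A0) (cst w1 + 'X^g *: cst w2).

(** The substitution turns the last row into [w1 + D^(-g) w2]; multiplying by the unit [D^g] brings
    the condition back to polynomials. *)
Lemma euclid_dual_spread (k m g : nat) (A0 : 'M[F]_(k, m)) w1 w2 u :
  euclid_dual (row_module (spread_mx g A0 w1 w2)) u <->
  u *m cst A0^T = 0 /\ 'X^g *: (u *m cst w1^T) + u *m cst w2^T = 0.
Proof.
have Xg0 : tofrac ('X^g : {poly F}) != 0.
  by rewrite tofrac_eq0 -size_poly_gt0 size_polyXn.
rewrite euclid_dualE.
have -> : invD_mx (spread_mx g A0 w1 w2) =
  col_mx (frac_mx (cst A0))
         (frac_mx (cst w1) + (tofrac 'X^g)^-1 *: frac_mx (cst w2)).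
  rewrite invD_mxE map_col_mx -!invD_cst !invD_mxE; congr col_mx.
  by rewrite map_mxD map_mxZ /= -/(invD _) invD_Xn tofracXn exprVn.
rewrite tr_col_mx mul_mx_row linearD linearZ /= mulmxDr -scalemxAr.
rewrite /frac_mx !map_trmx -!map_mxM.
split=> [|[-> ]].
  rewrite -row_mx0 => /eq_row_mx[E0 E1]; split; apply: frac_mx_inj.
    by rewrite /frac_mx E0 map_mx0.
  rewrite /frac_mx map_mxD map_mxZ map_mx0 -[X in _ *: _ + X](scalerKV Xg0).
  by rewrite -scalerDr E1 scaler0.
move=> E; rewrite map_mx0 -row_mx0; congr row_mx.
apply: (scalerI Xg0); rewrite scalerDr scalerKV // scaler0.
by rewrite -map_mxZ -map_mxD E map_mx0.
Qed.

Lemma exists_min_wt_diff (m : nat) (V W : 'rV[{poly F}]_m -> Prop) (d0 : nat) :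
  (exists v, V v /\ ~ W v) ->
  (forall v, V v -> ~ W v -> (d0 <= wt v)%N) ->
  exists d, is_min_wt_diff V W d /\ (d0 <= d)%N.
Proof.
move=> [v [Vv Wv]] wt_ge.
have [d] : exists d, (wt v <= d)%N by exists (wt v).
elim: d v Vv Wv => [|d IH] v Vv Wv wt_v.
  exists 0; split; first split.
  - by exists v; split=> //; apply/eqP; rewrite -leqn0.
  - by move=> u _ _; apply: leq0n.
  - exact: leq_trans (wt_ge v Vv Wv) wt_v.
case: (classic (exists u, [/\ V u, ~ W u & (wt u < wt v)%N])) => [[u [Vu Wu uv]]|no].
  by apply: (IH u) => //; rewrite -ltnS; apply: leq_trans uv wt_v.
exists (wt v); split; last exact: wt_ge.
split=> [|u Vu Wu]; first by exists v.
by rewrite leqNgt; apply/negP => uv; apply: no; exists u.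
Qed.

(** * Codes with a single nonconstant row *)

Section SpreadCode.

Variables (k s m g : nat) (A0 : 'M[F]_(k, m)) (w1 w2 : 'rV[F]_m).
Variables (B : 'M[F]_(s, m)) (P0 : 'M[F]_(m, k)) (p1 p2 : 'cV[F]_m).
Variables (PB : 'M[F]_(m, s)) (b : 'rV[F]_m) (z : 'cV[F]_m).
(** The constant matrix whose last two rows get merged. Right inverses certify independence of rows;
    [b] is orthogonal to [M], and [z] separates it from the rows of [B]. *)
Let M := col_mx (col_mx A0 w1) w2.
Hypothesis MP : M *m row_mx (row_mx P0 p1) p2 = 1%:M.
Hypothesis BPB : B *m PB = 1%:M.
Hypothesis BM : B *m M^T = 0.
Hypothesis bM : b *m M^T = 0.
Hypothesis Bz : B *m z = 0.
Hypothesis bz : b *m z != 0.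
Hypothesis g_gt0 : (0 < g)%N.

Let A := spread_mx g A0 w1 w2.

Let MPE : [/\ [/\ A0 *m P0 = 1%:M, A0 *m p1 = 0 & A0 *m p2 = 0],
  [/\ w1 *m P0 = 0, w1 *m p1 = 1%:M & w1 *m p2 = 0] &
  [/\ w2 *m P0 = 0, w2 *m p1 = 0 & w2 *m p2 = 1%:M]].
Proof.
move: MP; rewrite /M mul_col_row !mul_mx_row !mul_col_mx !scalar_mx_block.
rewrite -!block_mxEh => /eq_block_mx[/eq_block_mx[-> -> -> ->]].
rewrite -col_mx0 => /eq_col_mx[-> ->]; rewrite -row_mx0 => /eq_row_mx[-> ->] ->.
by [].
Qed.

(** The column [p1] sees only the constant part [w1] of the last row, so [A] has a constant right
    inverse. *)
Let AP1 : A *m cst (row_mx P0 p1) = 1%:M.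
Proof.
have [[E1 E2 E3] [E4 E5 E6] [E7 E8 E9]] := MPE.
rewrite /A /spread_mx map_row_mx mul_col_row !mulmxDl -!scalemxAl !cstM.
by rewrite E1 E2 E4 E5 E7 E8 !map_mx0 !scaler0 !addr0 !map_mx1 scalar_mx_block.
Qed.

(** The column [p2] sees only the leading part [w2]; this yields the determinant [X^g] that bounds
    the degree from below. *)
Let AP2 : A *m cst (row_mx P0 p2) = block_mx 1%:M 0 0 ('X^g)%:M.
Proof.
have [[E1 E2 E3] [E4 E5 E6] [E7 E8 E9]] := MPE.
rewrite /A /spread_mx map_row_mx mul_col_row !mulmxDl -!scalemxAl !cstM.
by rewrite E1 E3 E4 E6 E7 E9 !map_mx0 !scaler0 !addr0 add0r !map_mx1 scalemx1.
Qed.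

Let SP1 : stabilizer_mx A (cst B) *m
  cst (block_mx (row_mx P0 p1) 0 0 PB) = 1%:M.
Proof.
rewrite /stabilizer_mx map_block_mx !map_mx0 mulmx_block !mulmx0 !mul0mx.
by rewrite !addr0 add0r AP1 cstM BPB map_mx1 -scalar_mx_block.
Qed.

Let SP2 : \det (stabilizer_mx A (cst B) *m
  cst (block_mx (row_mx P0 p2) 0 0 PB)) = 'X^g.
Proof.
rewrite /stabilizer_mx map_block_mx !map_mx0 mulmx_block !mulmx0 !mul0mx.
rewrite !addr0 add0r AP2 cstM BPB map_mx1 det_ublock det1 mulr1.
by rewrite det_ublock det1 mul1r det_scalar1.
Qed.

Let constraint_length_leq : (constraint_length (stabilizer_mx A (cst B)) <= g)%N.
Proof.
have deg0 c : entry_deg (c%:P : {poly F}) = 0%N.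
  by rewrite /entry_deg size_polyC; case: eqP.
rewrite /constraint_length big_split_ord big_split_ord big_ord1 /=.
rewrite /stabilizer_mx block_mxEv.
rewrite big1 => [|i _]; last first.
  apply: big1 => j _; rewrite col_mxEu; case: (split_ordP j) => h ->.
    by rewrite row_mxEl col_mxEu mxE deg0.
  by rewrite row_mxEr mxE deg0.
rewrite [X in (_ + X)%N]big1 => [|i _]; last first.
  apply: big1 => j _; rewrite col_mxEd; case: (split_ordP j) => h ->.
    by rewrite row_mxEl mxE deg0.
  by rewrite row_mxEr mxE deg0.
rewrite add0n addn0; apply/bigmax_leqP => j _; rewrite col_mxEu.
case: (split_ordP j) => h ->; last by rewrite row_mxEr mxE deg0.
rewrite row_mxEl col_mxEd !mxE mulrC mul_polyC /entry_deg -subn1 leq_subLR.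
apply: leq_trans (size_polyD _ _) _; rewrite add1n geq_max.
rewrite (leq_trans (size_polyC_leq1 _)) //.
by apply: leq_trans (size_scale_leq _ _) _; rewrite size_polyXn.
Qed.

Let cM0 (c : 'rV[F]_m) : c *m A0^T = 0 -> c *m w1^T = 0 -> c *m w2^T = 0 ->
  c *m M^T = 0.
Proof.
by move=> E0 E1 E2; rewrite /M !tr_col_mx !mul_mx_row E0 E1 E2 !row_mx0.
Qed.

Let M0c (n : nat) (N : 'M[F]_(n, m)) : N *m M^T = 0 ->
  [/\ N *m A0^T = 0, N *m w1^T = 0 & N *m w2^T = 0].
Proof.
rewrite /M !tr_col_mx !mul_mx_row -row_mx0 => /eq_row_mx[+ ->].
by rewrite -row_mx0 => /eq_row_mx[-> ->].
Qed.

(** The word [w1] works: in a combination of rows of [A] equal to it, [p2] forces the last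
    coefficient to vanish, and [p1] forces it to be 1. *)
Let dualB_notA : exists v, euclid_dual (row_module (cst B)) v /\ ~ row_module A v.
Proof.
have [[E1 E2 E3] [E4 E5 E6] [E7 E8 E9]] := MPE.
have [BA0 Bw1 Bw2] := M0c BM.
exists (cst w1); split.
  by apply/euclid_dual_cst; rewrite cstM -[w1]trmxK -trmx_mul Bw1 trmx0 map_mx0.
move=> [u]; rewrite -[u]hsubmxK /A /spread_mx mul_row_col mulmxDr -scalemxAr => E.
have := congr1 (mulmx^~ (cst p2)) E.
rewrite !mulmxDl -!mulmxA -scalemxAl -mulmxA !cstM E3 E6 E9 !map_mx0 !mulmx0.
rewrite !add0r map_mx1 mulmx1 => /matrixP/(_ 0 0).
rewrite !mxE => /esym/eqP; rewrite mulf_eq0 -size_poly_eq0 size_polyXn /= => /eqP u0.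
have := congr1 (mulmx^~ (cst p1)) E.
rewrite !mulmxDl -!mulmxA -scalemxAl -mulmxA !cstM E2 E5 E8 !map_mx0 !mulmx0.
rewrite scaler0 add0r addr0 map_mx1 mulmx1 => /matrixP/(_ 0 0).
by rewrite !mxE u0 => /eqP; rewrite oner_eq0.
Qed.

Let dualA_notB : exists v, euclid_dual (row_module A) v /\ ~ row_module (cst B) v.
Proof.
have [bA0 bw1 bw2] := M0c bM.
exists (cst b); split.
  apply/euclid_dual_spread; rewrite !cstM bA0 bw1 bw2 !map_mx0.
  by rewrite scaler0 addr0.
move=> [u E]; have := congr1 (mulmx^~ (cst z)) E.
rewrite -mulmxA !cstM Bz map_mx0 mulmx0 -(map_mx0 (@polyC F)) => bz0.
case/eqP: bz; apply/matrixP => i j; apply: polyC_inj.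
by have /matrixP/(_ i j) := bz0; rewrite !mxE.
Qed.

Variables (d0 d1 d2 : nat).
Hypothesis dA0 : forall c, c *m A0^T = 0 -> c != 0 -> (d0 <= hamming_wt c)%N.
Hypothesis dM : forall c, c *m M^T = 0 -> c != 0 -> (d2 <= hamming_wt c)%N.
Hypothesis dB : forall c, c *m B^T = 0 -> c != 0 -> (d1 <= hamming_wt c)%N.
Hypothesis d0d2 : (d2 <= d0 + d0)%N.

Let coef_neq0 (v : 'rV[{poly F}]_m) : v != 0 -> exists i, coef_mx i v != 0.
Proof.
move=> v0; apply: NNPP => no; case/eqP: v0; apply: coef_mx_eq0 => i.
by apply/eqP/negPn/negP => vi; apply: no; exists i.
Qed.

Let wt_dualB v : euclid_dual (row_module (cst B)) v -> v != 0 -> (d1 <= wt v)%N.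
Proof.
move=> /euclid_dual_cst vB /coef_neq0[i vi].
apply: leq_trans (hamming_wt_coef v i); apply: dB => //.
by rewrite -coef_mx_cstr vB; apply/matrixP => a j; rewrite !mxE /= coef0.
Qed.

(* If [v] has a single nonzero coefficient [c], the two shifted constraints
   force [c] to be orthogonal to [w1] and [w2] separately; if it has two, each
   of them contributes at least [d0] to the weight. *)
Let wt_dualA v : euclid_dual (row_module A) v -> v != 0 -> (d2 <= wt v)%N.
Proof.
move=> /euclid_dual_spread[vA0 vw] /coef_neq0[i vi].
have cA0 j : coef_mx j v *m A0^T = 0.
  by rewrite -coef_mx_cstr vA0; apply/matrixP => a h; rewrite !mxE /= coef0.
case: (classic (exists2 j, i != j & coef_mx j v != 0)) => [[j ij vj]|single].
  apply: leq_trans (hamming_wt_coef2 v ij); apply: leq_trans d0d2 _.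
  by apply: leq_add; apply: dA0.
have vj j : i != j -> coef_mx j v = 0.
  by move=> ij; apply/eqP/negPn/negP => vj; apply: single; exists j.
(* The coefficient of [D^j] in the merged constraint. Taking [j = i + g] isolates [w1], and [j = i]
   isolates [w2]. *)
have vwj j : (if (j < g)%N then 0 else coef_mx (j - g) v *m w1^T)
    + coef_mx j v *m w2^T = 0.
  have := congr1 (coef_mx j) vw; rewrite -!coef_mx_cstr => /matrixP E.
  apply/matrixP => a h; have := E a h; rewrite !mxE /= coefD coefXnM coef0.
  by case: ifP => _; rewrite ?mxE //= => <-; rewrite !mxE.
apply: leq_trans (hamming_wt_coef v i); apply: dM => //; apply: cM0 => //.
  have := vwj (i + g)%N; rewrite ltnNge leq_addl /= addnK (vj (i + g)%N).
    by rewrite mul0mx addr0.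
  by rewrite -[X in X != _]addn0 eqn_add2l eq_sym -lt0n.
have := vwj i; case: ifP => [_|/negbT]; first by rewrite add0r.
rewrite -leqNgt => gi; rewrite vj ?mul0mx ?add0r //.
by rewrite gtn_eqF // ltn_subrL g_gt0 (leq_trans g_gt0).
Qed.

Lemma spread_AQCC (K bdz bdx : nat) : (K + (k + 1) + s = m)%N ->
  (bdz <= d1)%N -> (bdx <= d2)%N ->
  exists mu, has_AQCC F m K mu g (dist_bounds bdz bdx).
Proof.
move=> dimK le1 le2.
have nz (r : nat) (R : 'M[{poly F}]_(r, m)) v : ~ row_module R v -> v != 0.
  by move=> Rv; apply/eqP => v0; apply: Rv; exists 0; rewrite mul0mx.
have [e1 [min1 ge1]] := exists_min_wt_diff dualB_notA
  (fun v Vv Wv => wt_dualB Vv (nz _ _ _ Wv)).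
have [e2 [min2 ge2]] := exists_min_wt_diff dualA_notB
  (fun v Vv Wv => wt_dualA Vv (nz _ _ _ Wv)).
have basicS : is_basic (stabilizer_mx A (cst B)) by eexists; apply: SP1.
have minS := constraint_length_min basicS SP2.
exists (memory (stabilizer_mx A (cst B))).
exists (k + 1)%N, s, A, (cst B), (maxn e1 e2), (minn e1 e2); split; last first.
  have {}ge1 := leq_trans le1 ge1; have {}ge2 := leq_trans le2 ge2.
  (* In either order, the smaller bound lies below both [e1] and [e2], the larger below one of
     them. *)
  rewrite /dist_bounds; case: ltnP => lt_b; rewrite !leq_max !leq_min ?ge1 ?ge2.
    by rewrite orbT (leq_trans (ltnW lt_b)).
  by rewrite (leq_trans lt_b).
split=> //.
- have [BA0 Bw1 Bw2] := M0c BM.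
  have AB : A *m cst B^T = 0.
    rewrite /A /spread_mx mul_col_mx mulmxDl -scalemxAl !cstM.
    rewrite -[A0]trmxK -[w1]trmxK -[w2]trmxK -!trmx_mul BA0 Bw1 Bw2 !trmx0.
    by rewrite !map_mx0 scaler0 addr0 col_mx0.
  by rewrite invD_cst /frac_mx !map_trmx -map_mxM AB map_mx0.
- by apply/eqP; rewrite eqn_leq constraint_length_leq minS.
- by exists e1, e2.
Qed.

End SpreadCode.

(** * Power sums over the field *)

Let q : nat := #|F|.

Let q_gt1 : (1 < q)%N := finNzRing_gt1 F.

Definition power_sum (e : nat) : F := \sum_(x : F) x ^+ e.

Arguments power_sum e%_N.

Lemma power_sum_small (e : nat) : (e < q.-1)%N -> power_sum e = 0.
Proof.
rewrite /power_sum; case: e => [_|e lt_e].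
  (* Summing [x + 1] instead of [x] over the field changes nothing. *)
  apply: (addrI (\sum_(x : F) x)); rewrite addr0 -big_split /=.
  under eq_bigr => x _ do rewrite expr0.
  by rewrite [RHS](reindex_inj (addIr 1)).
(* Fewer than [q - 1] elements satisfy [y^e = 1] for the positive exponent; scaling by another
   nonzero [y] then multiplies the sum by a factor other than 1. *)
have [y y0 ye] : exists2 y : F, y != 0 & y ^+ e.+1 != 1.
  apply: NNPP => no; suff : (q.-1 <= e.+1)%N by lia.
  rewrite -(cardC1 (0 : F)) cardE; apply: max_unity_roots; rewrite ?enum_uniq //.
  apply/allP => x; rewrite mem_enum inE => x0; apply/unity_rootP.
  by apply/eqP/negPn/negP => xe; apply: no; exists x.
apply/eqP; move: ye; rewrite -subr_eq0 => /mulfI/inj_eq <-; rewrite mulr0.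
rewrite mulrBl mul1r subr_eq0 mulr_sumr; apply/eqP.
rewrite [RHS](reindex_inj (mulfI y0)).
by apply: eq_bigr => x _; rewrite exprMn.
Qed.

(** From [x^q = x]; exponent 0 is excluded because [0^0 = 1]. *)
Lemma power_sum_periodic (e : nat) :
  (0 < e)%N -> power_sum (q.-1 + e) = power_sum e.
Proof.
case: e => // e _; apply: eq_bigr => x _.
by rewrite addnS -addSn prednK ?(ltnW q_gt1) // exprD expf_card exprS.
Qed.

Lemma power_sum_pred_card : power_sum q.-1 = -1.
Proof.
have Efermat (x : F) : x != 0 -> x ^+ q.-1 = 1.
  by move=> x0; apply: (mulfI x0); rewrite -exprS prednK ?expf_card ?mulr1 // ltnW.
(* The sum for exponent 0 vanishes and differs from this one only by the term [0^0 = 1]. *)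
have := @power_sum_small 0; rewrite ltn_predRL => /(_ q_gt1)/eqP.
rewrite /power_sum (bigD1 (0 : F)) //= expr0 addrC addr_eq0 => /eqP <-.
rewrite (bigD1 (0 : F)) //= expr0n eqn0Ngt ltn_predRL q_gt1 /= add0r.
by apply: eq_bigr => x x0; rewrite expr0 Efermat.
Qed.

(** * Weight bound and evaluation vectors *)

Lemma vandermonde_wt (f : F -> F) (N : nat) :
  (forall j, (j < N)%N -> \sum_x f x * x ^+ j = 0) ->
  (forall x, f x = 0) \/ (N < \sum_x (f x != 0%R))%N.
Proof.
move=> f_orth; case: (classic (forall x, f x = 0)) => [|/not_all_ex_not[x0 fx0]].
  by left.
right; rewrite ltnNge; apply/negP => le_N.
pose D : {pred F} := [pred x | (f x != 0) && (x != x0)].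
(* [p] vanishes on the support of [f] except at [x0], and its size is at most [N]: orthogonality
   gives [f x0 * p.[x0] = 0]. *)
pose p := \prod_(y <- enum D) ('X - y%:P).
have size_p : (size p <= N)%N.
  rewrite size_prod_XsubC -cardE; apply: leq_trans le_N.
  rewrite (bigD1 x0) //=; move/eqP: fx0 => ->; rewrite add1n ltnS -sum1_card.
  rewrite big_mkcond [leqRHS]big_mkcond /=; apply: leq_sum => x _.
  by rewrite !inE; case: (x != x0); rewrite ?andbF ?andbT //; case: (f x != 0).
have : \sum_x f x * p.[x] = 0.
  under eq_bigr => x _ do rewrite horner_coef mulr_sumr.
  rewrite exchange_big big1 //= => j _.
  under eq_bigr => x _ do rewrite mulrCA.
  by rewrite -mulr_sumr f_orth ?mulr0 // (leq_trans (ltn_ord j)).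
rewrite (bigD1 x0) //= big1 ?addr0 => [/eqP|x xx0].
  rewrite mulf_eq0; move/eqP/negPf: fx0 => -> /=; rewrite -rootE root_prod_XsubC.
  by rewrite mem_enum !inE eqxx andbF.
have [->|fx] := eqVneq (f x) 0; first by rewrite mul0r.
suff /rootP-> : root p x by rewrite mulr0.
by rewrite root_prod_XsubC mem_enum !inE fx.
Qed.

(* The last coordinate is the point at infinity. *)
Definition ext_eval (f : F -> F) (a : F) : 'rV[F]_(q + 1) :=
  row_mx (\row_(j < q) f (enum_val j)) a%:M.

Lemma ext_eval_surj (c : 'rV[F]_(q + 1)) : exists f a, c = ext_eval f a.
Proof.
exists (fun x => c 0 (lshift 1 (enum_rank x))), (c 0 (rshift q 0)).
rewrite -[LHS]hsubmxK; congr row_mx.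
  by apply/rowP => j; rewrite !mxE enum_valK.
by apply/rowP => j; rewrite !mxE !ord1 mulr1n.
Qed.

Lemma ext_eval_dot (f g : F -> F) (a b : F) :
  (ext_eval f a *m (ext_eval g b)^T) 0 0 = \sum_x f x * g x + a * b.
Proof.
rewrite tr_row_mx mul_row_col !mxE big_ord1 !mxE !mulr1n; congr (_ + _).
by rewrite [RHS]big_enum_val; apply: eq_bigr => j _; rewrite !mxE.
Qed.

Lemma hamming_wt_ext_eval (f : F -> F) (a : F) :
  hamming_wt (ext_eval f a) = (\sum_x (f x != 0%R) + (a != 0%R))%N.
Proof.
rewrite /hamming_wt big_split_ord big_ord1 /= row_mxEr !mxE mulr1n.
congr (_ + _)%N; rewrite [RHS]big_enum_val; apply: eq_bigr => j _.
by rewrite row_mxEl mxE.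
Qed.

Definition ext_monom (e : nat) (a : F) := ext_eval (fun x => x ^+ e) a.

Arguments ext_monom e%_N a.

Lemma ext_monom_dot (e e' : nat) (a a' : F) :
  (ext_monom e a *m (ext_monom e' a')^T) 0 0 = power_sum (e + e') + a * a'.
Proof.
rewrite ext_eval_dot; congr (_ + _); apply: eq_bigr => x _.
by rewrite exprD.
Qed.

(** Up to sign, the complementary monomials form a dual family; the right inverses [P] and [PB] come
    from it. *)
Lemma power_sum_shift (d d' : nat) :
  (d < q.-1)%N -> (d' < q.-1)%N ->
  power_sum (d + (q.-1 - d')) = - (d == d')%:R.
Proof.
move=> ltd ltd'; have [->|ne] := eqVneq d d'.
  by rewrite subnKC ?power_sum_pred_card // ltnW.
rewrite oppr0; case: (ltnP d d') => le_d.
  by apply: power_sum_small; lia.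
have -> : (d + (q.-1 - d') = q.-1 + (d - d'))%N by lia.
by rewrite power_sum_periodic ?power_sum_small //; lia.
Qed.

Lemma mul_rows_trE (r r' m : nat) (C : 'M[F]_(r, m)) (D : 'M[F]_(r', m)) i j :
  (C *m D^T) i j = (row i C *m (row j D)^T) 0 0.
Proof. by rewrite !mxE; apply: eq_bigr => h _; rewrite !mxE. Qed.

Definition ext_monom_mx (r : nat) (e : nat -> nat) (a : nat -> F) :
    'M[F]_(r, q + 1) :=
  \matrix_(l < r) ext_monom (e l) (a l).

Arguments ext_monom_mx r%_N e a.

Lemma ext_eval_orth (r : nat) (e : nat -> nat) (a : nat -> F) f b :
  ext_eval f b *m (ext_monom_mx r e a)^T = 0 ->
  forall l, (l < r)%N -> \sum_x f x * x ^+ e l + b * a l = 0.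
Proof.
move=> /matrixP orth l ltl; have := orth 0 (Ordinal ltl).
by rewrite mul_rows_trE row_id rowK ext_eval_dot [RHS]mxE.
Qed.

(** * The nested evaluation codes *)

Section NestedEvaluationCodes.

Variables (i t : nat).
Hypotheses (t_gt0 : (0 < t)%N) (lt_ti : (t < i)%N) (lt_iF : (2 * i < q)%N).

(** With degree [2 * i] first, every nonempty prefix of rows contains it, and the last two rows have
    degrees [2t - 1] and [2t]. *)
Let eM (l : nat) : nat := if l is l'.+1 then l' else (2 * i)%N.
Let aM (l : nat) : F := (l == 0%N)%:R.
Let M := ext_monom_mx (2 * t + 1 + 1) eM aM.

Let aB (l : nat) : F := (l == q.-1 - 2 * i)%N%:R.
Let B := ext_monom_mx (q - 2 * i) id aB.

(** The entry at infinity is chosen to cancel the pairing with the row of degree [2 * i]. *)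
Let P_row (l : nat) : 'rV[F]_(q + 1) :=
  if l is l'.+1 then
    - ext_monom (q.-1 - l') (- power_sum (2 * i + (q.-1 - l')))
  else ext_eval (fun=> 0) 1.
Let P : 'M[F]_(q + 1, 2 * t + 1 + 1) := (\matrix_(l < _) P_row l)^T.

Let MP : M *m P = 1%:M.
Proof.
apply/matrixP => -[l ltl] [l' ltl']; rewrite mul_rows_trE !rowK [RHS]mxE -val_eqE /=.
case: l' ltl' => [_|l' ltl'] /=.
  rewrite ext_eval_dot big1 ?add0r ?mulr1 // => x _; exact: mulr0.
rewrite linearN /= mulmxN [LHS]mxE ext_monom_dot; case: l ltl => [_|l ltl] /=.
  by rewrite mul1r subrr oppr0.
by rewrite mul0r addr0 power_sum_shift ?opprK //; lia.
Qed.

Let PB : 'M[F]_(q + 1, q - 2 * i) :=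
  (- ext_monom_mx _ (fun l => q.-1 - l)%N (fun=> 0))^T.

Let BPB : B *m PB = 1%:M.
Proof.
rewrite /PB linearN /= mulmxN; apply/matrixP => -[l ltl] [l' ltl'].
rewrite [LHS]mxE mul_rows_trE !rowK [RHS]mxE -val_eqE /= ext_monom_dot mulr0 addr0.
by rewrite power_sum_shift ?opprK //; lia.
Qed.

(** Degrees add up to at most [q - 1]; when this is reached, the product 1 at infinity cancels the
    power sum -1. *)
Let BM : B *m M^T = 0.
Proof.
apply/matrixP => -[l ltl] [l' ltl']; rewrite mul_rows_trE !rowK [RHS]mxE /=.
rewrite ext_monom_dot /aB /aM; case: l' ltl' => [_|l' ltl'] /=; last first.
  by rewrite mulr0 addr0 power_sum_small //; lia.
rewrite mulr1; have [->|ne] := eqVneq l (q.-1 - 2 * i)%N.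
  by rewrite subnK ?power_sum_pred_card ?addNr //; lia.
by rewrite addr0 power_sum_small //; lia.
Qed.

(** The degree is one above those in [B]. Against [x^(2i)] the exponent [q] reduces to 1, and the
    degree of [z] completes it to [q - 1]. *)
Let b : 'rV[F]_(q + 1) := ext_monom (q - 2 * i) 0.
Let z : 'cV[F]_(q + 1) := (ext_monom (2 * i).-1 0)^T.

Let bM : b *m M^T = 0.
Proof.
apply/matrixP => r [l ltl]; rewrite mul_rows_trE row_id rowK [RHS]mxE /=.
rewrite ext_monom_dot mul0r addr0; case: l ltl => [_|l ltl] /=; last first.
  by rewrite power_sum_small //; lia.
have -> : (q - 2 * i + 2 * i = q.-1 + 1)%N by lia.
by rewrite power_sum_periodic ?power_sum_small //; lia.
Qed.

Let Bz : B *m z = 0.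
Proof.
apply/matrixP => -[l ltl] r; rewrite mul_rows_trE row_id rowK [RHS]mxE /=.
by rewrite ext_monom_dot mulr0 addr0 power_sum_small //; lia.
Qed.

Let bz : b *m z != 0.
Proof.
apply/eqP => /matrixP/(_ 0 0)/eqP; rewrite ext_monom_dot mulr0 addr0 mxE.
have -> : (q - 2 * i + (2 * i).-1 = q.-1)%N by lia.
by rewrite power_sum_pred_card oppr_eq0 oner_eq0.
Qed.

Let ext_eval0 f a : (forall x, f x = 0) -> a = 0 -> ext_eval f a = 0.
Proof.
move=> f0 ->; rewrite /ext_eval -row_mx0; congr row_mx.
  by apply/rowP => j; rewrite !mxE f0.
by apply/rowP => j; rewrite !mxE mul0rn.
Qed.

(* The rows of degrees [0, ..., r - 2] bound the finite part of the support;
   the row of degree [2 * i] excludes words supported at infinity only. *)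
Let dM_sub (r : nat) c : (0 < r)%N ->
  c *m (ext_monom_mx r eM aM)^T = 0 -> c != 0 -> (r <= hamming_wt c)%N.
Proof.
have [f [a ->]] := ext_eval_surj c; move=> r_gt0 /ext_eval_orth orth c0.
have f_orth l : (l < r.-1)%N -> \sum_x f x * x ^+ l = 0.
  by move=> ltl; have := orth l.+1; rewrite mulr0 addr0 => -> //; lia.
rewrite hamming_wt_ext_eval; have [f0|] := vandermonde_wt f_orth; last by lia.
case/eqP: c0; apply: ext_eval0 => //; have := orth 0%N r_gt0.
by rewrite big1 ?add0r ?mulr1 // => x _; rewrite f0 mul0r.
Qed.

Let dB c : c *m B^T = 0 -> c != 0 -> (q - 2 * i + 1 <= hamming_wt c)%N.
Proof.
have [f [a ->]] := ext_eval_surj c; move=> /ext_eval_orth orth c0.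
rewrite hamming_wt_ext_eval.
have f_orth l : (l < q.-1 - 2 * i)%N -> \sum_x f x * x ^+ l = 0.
  move=> ltl; have := orth l; rewrite /aB.
  have -> : (l == q.-1 - 2 * i)%N = false by lia.
  by rewrite mulr0 addr0 => -> //; lia.
(* If [a = 0], the last row gives one more condition on [f]; otherwise the coordinate at infinity
   supplies the missing unit of weight. *)
have [a0|a0] := eqVneq a 0.
  have f_orth' l : (l < q - 2 * i)%N -> \sum_x f x * x ^+ l = 0.
    by move=> ltl; have := orth l ltl; rewrite a0 mul0r addr0.
  have [f0|] := vandermonde_wt f_orth'; last by lia.
  by case/eqP: c0; apply: ext_eval0.
have [f0|] := vandermonde_wt f_orth; last by lia.
case/eqP: a0; have := orth (q.-1 - 2 * i)%N.
by rewrite /aB eqxx mulr1 big1 => [|x _]; rewrite ?f0 ?mul0r // add0r; apply; lia.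
Qed.

Lemma nested_evaluation_AQCC (g bdz bdx : nat) : (0 < g)%N ->
  (bdz <= q - 2 * i + 1)%N -> (bdx <= 2 * t + 2)%N ->
  exists mu, has_AQCC F (q + 1) (2 * i - 2 * t) mu g (dist_bounds bdz bdx).
Proof.
move=> g_gt0 le1 le2.
have EM : col_mx (col_mx (usubmx (usubmx M)) (dsubmx (usubmx M))) (dsubmx M) = M.
  by rewrite !vsubmxK.
have EP : row_mx (row_mx (lsubmx (lsubmx P)) (rsubmx (lsubmx P))) (rsubmx P) = P.
  by rewrite !hsubmxK.
have EA0 : usubmx (usubmx M) = ext_monom_mx (2 * t) eM aM.
  by apply/row_matrixP => l; rewrite rowK; apply/rowP => j; rewrite !mxE.
apply: (@spread_AQCC _ _ _ g (usubmx (usubmx M)) (dsubmx (usubmx M)) (dsubmx M)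
  B (lsubmx (lsubmx P)) (rsubmx (lsubmx P)) (rsubmx P) PB b z) le1 le2;
  rewrite ?EM ?EP ?EA0 //.
- by move=> c; apply: dM_sub; lia.
- by move=> c cM c0; have := dM_sub _ cM c0; lia.
- by lia.
- by lia.
Qed.

End NestedEvaluationCodes.

End ConvolutionalCodes.

Local Open Scope nat_scope.

Theorem theorem3p6 (p l : nat) (F : finFieldType) (p_prime : prime p)
    (p_odd : odd p) (l_ge2 : 2 <= l) (card_F : #|F| = p ^ l) :
  let q := p ^ l in
  let n := q + 1 in
  let a := n %/ 2 in
  (forall i t : nat, 1 <= t -> t <= i - 2 -> 3 <= i -> i <= a - 1 ->
     exists mu : nat,
       has_AQCC F n (2 * i - 2 * t - 2) mu 6
         (dist_bounds (n - 2 * i) (2 * t + 2)))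
  /\
  (forall i t : nat, 1 <= t -> t <= i - 1 -> 2 <= i -> i <= a - 1 ->
     exists mu : nat,
       has_AQCC F n (2 * i - 2 * t) mu 4
         (dist_bounds (n - 2 * i) (2 * t + 2))).
Proof.
rewrite -card_F => q n a; split=> i t t_gt0 le_t le_i le_a.
  (* Replacing [t] by [t + 1] gives the stronger bound [2t + 4]. *)
  have -> : 2 * i - 2 * t - 2 = 2 * i - 2 * t.+1 by lia.
  by apply: nested_evaluation_AQCC; lia.
by apply: nested_evaluation_AQCC; lia.
Qed.
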